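(* Let $M\le N$ and suppose at least one source direction is retained ($d\ge1$). The norm of the inverse of the diagonal operator with entries $\sqrt{d_{\alpha,N}}$ on the coordinates $|\alpha|\le M$, $\operatorname{supp}\alpha\subset\{1,\dots,d\}$, is exactly $\chi_{M,N}$, that is, $\max_{|\alpha|\le M,\ \operatorname{supp}\alpha\subset\{1,\dots,d\}}d_{\alpha,N}^{-1/2}=\chi_{M,N}$. Moreover $$\frac{M(M-1)}{4N}\le\log\chi_{M,N}\le\frac{M(M-1)}{4(N-M+1)}.$$ As $N\to\infty$ with $M=M_N\le N$: if $M/\sqrt N\to c<\infty$ then $\chi_{M,N}\to e^{c^2/4}$, while if $M/\sqrt N\to\infty$ then $\chi_{M,N}\to\infty$. For sequences with $M\le N$, these inverse norms are asymptotically bounded exactly when $M^2/N$ is bounded.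
   Context: $(N)_{\underline m}=N(N-1)\cdots(N-m+1)$, $(N)_{\underline0}=1$. For a finitely supported multi-index $\alpha$, $d_{\alpha,N}=\prod_j(N)_{\underline{\alpha_j}}/N^{\alpha_j}$. $\chi_{m,N}=\big(N^m/(N)_{\underline m}\big)^{1/2}$ for $m\le N$, $\chi_{0,N}=1$. *)

(* Defs.v *)
From HB Require Import structures.
From mathcomp Require Import all_boot all_order all_algebra.
From mathcomp Require Import finmap.
From mathcomp Require Import all_classical all_reals all_analysis.

Set Implicit Arguments.
Unset Strict Implicit.
Unset Printing Implicit Defensive.

Import Order.TTheory GRing.Theory Num.Theory.
Import numFieldNormedType.Exports.

Local Open Scope classical_set_scope.
Local Open Scope ring_scope.

Definition multiindex := {fsfun nat -> nat with 0%N}.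

Definition mdeg (a : multiindex) : nat := (\sum_(j <- finsupp a) a j)%N.

(* Source directions are numbered from 1; index 0 is never in the support of a
   retained multi-index. *)
Definition retained (d M : nat) (a : multiindex) : bool :=
  (mdeg a <= M)%N && all (fun j => (1 <= j <= d)%N) (finsupp a).

Record coords (d M : nat) := Coords {
  coords_val :> multiindex;
  coords_valP : retained d M coords_val
}.

HB.instance Definition _ d M := [isSub for @coords_val d M].
HB.instance Definition _ d M := [Countable of coords d M by <:].

(* A retained multi-index is determined by its values on {0, ..., d}, all at
   most M, so [coords d M] is finite. *)
Section CoordsFinite.
Variables d M : nat.

Definition coords_code (a : coords d M) : {ffun 'I_d.+1 -> 'I_M.+1} :=
  [ffun j : 'I_d.+1 => inord (coords_val a j)].

Definition coords_decode (h : {ffun 'I_d.+1 -> 'I_M.+1}) : option (coords d M) :=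
  insub ([fsfun j in [fset (nat_of_ord i) | i in 'I_d.+1]%fset =>
            nat_of_ord (h (inord j))] : multiindex).

Lemma coords_codeK : pcancel coords_code coords_decode.
Proof.
move=> [a ra]; rewrite /coords_decode.
set b := (X in insub X).
suff -> : b = a by rewrite insubT.
have /andP[dega /allP suppa] := ra.
have aM j : (a j < M.+1)%N.
  have [ja|/fsfun_dflt -> //] := boolP (j \in finsupp a).
  rewrite ltnS (leq_trans _ dega)// /mdeg (big_rem j)//= leq_addr//.
apply/fsfunP => j; rewrite /b fsfunE.
case: ifPn => [/imfsetP[i _ ->]|jd].
  by rewrite ffunE inordK// inordK.
rewrite fsfun_dflt//; apply: contra jd => /suppa /andP[_ jd].
by apply/imfsetP; exists (inord j); rewrite ?inordK.
Qed.

HB.instance Definition _ :=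
  fintype.isFinite.Build (coords d M) (pcan_enumP coords_codeK).
End CoordsFinite.

Section Definitions.
Variable R : realType.

Definition dcoef (N : nat) (a : multiindex) : R :=
  \prod_(j <- finsupp a) ((N ^_ (a j))%:R / N%:R ^+ a j).

Definition chi (m N : nat) : R := Num.sqrt (N%:R ^+ m / (N ^_ m)%:R).

(* The norm instance of mathcomp-analysis on matrices is the sup norm, whereas the
   operator acts on coordinates with the Euclidean norm. *)
Definition l2norm (n : nat) (x : 'cV[R]_n) : R :=
  Num.sqrt (\sum_i x i 0 ^+ 2).

Definition opnorm (n : nat) (A : 'M[R]_n) : R :=
  sup [set l2norm (A *m x) | x in [set x : 'cV[R]_n | l2norm x <= 1]].

Definition diagop (d M N : nat) : 'M[R]_#|{: coords d M}| :=
  diag_mx (\row_i Num.sqrt (dcoef N (enum_val i : coords d M))).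
End Definitions.

(* Main.v *)
Require Import Defs.
From mathcomp Require Import all_boot all_order all_algebra.
From mathcomp Require Import finmap.
From mathcomp Require Import all_classical all_reals all_analysis.
From mathcomp Require Import ring lra.

(** Write r(m) for the ratio of the falling factorial (N)_m to N^m, so that
    d_{alpha,N} is the product of the r(alpha_j) and chi_{m,N} = r(m)^(-1/2).

    Everything about the norm comes from r being submultiplicative:
    r(m + n) <= r(m) r(n), because the last n factors of (N)_{m+n} are at most
    the n factors of (N)_n.  Hence d_alpha >= r(|alpha|) >= r(M) for every
    retained alpha ([ffratio_le_dcoef]), with equality when the whole mass M
    sits on a single direction, which is possible as soon as d >= 1.  The
    inverse of a diagonal operator is diagonal, and the Euclidean norm of a
    diagonal operator is its largest entry in absolute value
    ([opnorm_diag_mx]); so the norm of the inverse is chi_{M,N}.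

    For the size of chi, the increment of log chi from m to m + 1 is
    (1/2) log (N / (N - m)), and m / N <= log (N / (N - m)) <= m / (N - m)
    follows from log (1 + x) <= x.  For m < M the upper bound is at most
    m / (N - M + 1), and adding up the increments gives the two-sided estimate
    ([ln_chi_ge], [ln_chi_le]).

    The asymptotic claims only use this estimate.  Put t = M / sqrt N and
    u = M / N.  The lower bound is (t^2 - u) / 4 and the upper one is
    this divided by 1 - u + 1 / N.  If t converges while N tends to infinity,
    then u tends to 0 and both bounds tend to c^2 / 4.  Since u <= 1, the
    lower bound together with exp x >= 1 + x also gives
    chi >= 3/4 + t^2 / 4 ([chi_ge]), which settles divergence and one half of
    the boundedness criterion.  For the other half, M^2 <= C N keeps the upper
    bound under control, whether N is large compared with M or both M and N
    are bounded in terms of C ([ln_chi_le_of_sqr_div_le]). *)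

Set Implicit Arguments.
Unset Strict Implicit.
Unset Printing Implicit Defensive.

Import Order.TTheory GRing.Theory Num.Theory.
Import numFieldNormedType.Exports.

Local Open Scope classical_set_scope.
Local Open Scope ring_scope.

(** * The normalized falling factorial *)

(** This is the coefficient [dcoef] of a multi-index carried by one direction;
    it is also the probability that [m] uniform draws among [N] items are
    pairwise distinct.  The boundary value [ffratio R 0 0 = 1] makes the
    statements below valid for [N = 0]. *)
Definition ffratio (R : realType) (N m : nat) : R := (N ^_ m)%:R / N%:R ^+ m.

Lemma ffact_le_expn (N m : nat) : (N ^_ m <= N ^ m)%N.
Proof.
elim: m => [//|m IH]; rewrite ffactnSr expnSr.
by rewrite leq_mul// leq_subr.
Qed.

(** The factors [N - m - i] contributed by the last [n] terms are at most the
    factors [N - i] of [N ^_ n]. *)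
Lemma ffactD_le (N m n : nat) : (N ^_ (m + n) <= N ^_ m * N ^_ n)%N.
Proof.
elim: n => [|n IH]; first by rewrite addn0 muln1.
rewrite addnS !ffactnSr mulnA leq_mul//.
by rewrite leq_sub2l// leq_addl.
Qed.

Lemma ffratio_ge0 (R : realType) (N m : nat) : 0 <= ffratio R N m.
Proof. by rewrite /ffratio divr_ge0// exprn_ge0. Qed.

Lemma ffratio0 (R : realType) (N : nat) : ffratio R N 0 = 1.
Proof. by rewrite /ffratio ffactn0 expr0 divr1. Qed.

Lemma ffratio_gt0 (R : realType) (N m : nat) : (m <= N)%N -> 0 < ffratio R N m.
Proof.
case: m => [_|m mN]; first by rewrite ffratio0.
have N0 : (0 < N)%N by apply: leq_trans mN.
by rewrite /ffratio divr_gt0// ?exprn_gt0 ?ltr0n// ffact_gt0.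
Qed.

Lemma ffratio_le1 (R : realType) (N m : nat) : ffratio R N m <= 1.
Proof.
rewrite /ffratio -natrX; have [->|N0] := posnP (N ^ m).
  by rewrite invr0 mulr0.
by rewrite ler_pdivrMr ?ltr0n// mul1r ler_nat ffact_le_expn.
Qed.

Lemma ffratioD_le (R : realType) (N m n : nat) :
  ffratio R N (m + n) <= ffratio R N m * ffratio R N n.
Proof.
rewrite /ffratio mulf_div -exprD -natrM ler_wpM2r//.
by rewrite ler_nat ffactD_le.
Qed.

(** Submultiplicativity, with a second factor at most [1]. *)
Lemma ffratio_anti (R : realType) (N m n : nat) :
  (m <= n)%N -> ffratio R N n <= ffratio R N m.
Proof.
move=> mn; rewrite -(subnKC mn) (le_trans (ffratioD_le _ _ _ _))//.
by rewrite ler_piMr ?ffratio_ge0 ?ffratio_le1.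
Qed.

Lemma chiE (R : realType) (m N : nat) :
  chi R m N = (Num.sqrt (ffratio R N m))^-1.
Proof. by rewrite /chi -sqrtrV ?ffratio_ge0// /ffratio invf_div. Qed.

(** * Extremal multi-indices *)

(** Merging all directions into one can only lower the coefficient: this is
    submultiplicativity iterated along the support. *)
Lemma ffratio_mdeg_le_dcoef (R : realType) (N : nat) (a : multiindex) :
  ffratio R N (mdeg a) <= dcoef R N a.
Proof.
rewrite /mdeg /dcoef; elim: (enum_fset (finsupp a)) => [|j s IH].
  by rewrite !big_nil ffratio0.
rewrite !big_cons (le_trans (ffratioD_le _ _ _ _))//.
by rewrite ler_wpM2l// ffratio_ge0.
Qed.

Lemma coords_mdeg (d M : nat) (a : coords d M) : (mdeg a <= M)%N.
Proof. by have /andP[] := coords_valP a. Qed.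

Lemma ffratio_le_dcoef (R : realType) (N d M : nat) (a : coords d M) :
  ffratio R N M <= dcoef R N a.
Proof.
apply: le_trans (ffratio_mdeg_le_dcoef R N a).
exact: ffratio_anti (coords_mdeg a).
Qed.

(** The extremal multi-index: all the mass on the first direction, the only one
    that is available for every [d >= 1].  For [M = 0] it is the zero
    multi-index, whose support is empty; this is why its support is computed
    by cases. *)
Definition pure_multiindex (M : nat) : multiindex :=
  [fsfun j in [fset 1%N]%fset => M].

Lemma finsupp_pure_multiindex (M : nat) :
  finsupp (pure_multiindex M) = (if M == 0%N then fset0 else [fset 1%N])%fset.
Proof.
apply/fsetP => j; rewrite mem_finsupp fsfunE inE.
by have [->|M0] := eqVneq M 0%N; rewrite !inE; case: (j == 1%N); rewrite ?eqxx.
Qed.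

Lemma mdeg_pure_multiindex (M : nat) : mdeg (pure_multiindex M) = M.
Proof.
rewrite /mdeg finsupp_pure_multiindex; have [->|M0] := eqVneq M 0%N.
  by rewrite big_seq_fset0.
by rewrite big_seq_fset1 fsfunE inE eqxx.
Qed.

Lemma dcoef_pure_multiindex (R : realType) (N M : nat) :
  dcoef R N (pure_multiindex M) = ffratio R N M.
Proof.
rewrite /dcoef finsupp_pure_multiindex; have [->|M0] := eqVneq M 0%N.
  by rewrite big_seq_fset0 ffratio0.
by rewrite big_seq_fset1 fsfunE inE eqxx.
Qed.

Lemma retained_pure_multiindex (d M : nat) :
  (1 <= d)%N -> retained d M (pure_multiindex M).
Proof.
move=> d1; rewrite /retained mdeg_pure_multiindex leqnn/=.
apply/allP => j; rewrite finsupp_pure_multiindex.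
by case: eqP => _; rewrite !inE// => /eqP->.
Qed.

(** * Diagonal operators on Euclidean space *)

(** The bound holds coordinate by coordinate on squares, and the basis vector of
    a coordinate [k] where the largest modulus is reached attains it.  The index
    [k] also rules out [n = 0], where the norm would be [0] for any [c]. *)
Lemma opnorm_diag_mx (R : realType) (n : nat) (v : 'rV[R]_n) (c : R) (k : 'I_n) :
  (forall i, `|v 0 i| <= c) -> `|v 0 k| = c -> opnorm (diag_mx v) = c.
Proof.
move=> vc vk; have c0 : 0 <= c by rewrite -vk normr_ge0.
have l2v (x : 'cV[R]_n) : l2norm (diag_mx v *m x) <= c * l2norm x.
  rewrite /l2norm -[c in leRHS](ger0_norm c0) -sqrtr_sqr -sqrtrM ?sqr_ge0//.
  rewrite ler_wsqrtr// mulr_sumr ler_sum// => i _.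
  rewrite mul_diag_mx mxE exprMn ler_wpM2r ?sqr_ge0//.
  by rewrite -[v 0 i ^+ 2]real_normK ?num_real// lerXn2r ?nnegrE.
have ub : ubound [set l2norm (diag_mx v *m x) |
    x in [set x : 'cV[R]_n | l2norm x <= 1]] c.
  move=> _ [x /= x1 <-]; rewrite (le_trans (l2v x))//.
  by rewrite -[leRHS]mulr1 ler_wpM2l.
have l2e (b : R) : l2norm (b *: delta_mx k 0 : 'cV[R]_n) = `|b|.
  rewrite /l2norm (bigD1 k)//= big1 => [|i ik].
    by rewrite !mxE !eqxx mulr1 addr0 sqrtr_sqr.
  by rewrite !mxE (negPf ik) mulr0 expr0n.
have cE : [set l2norm (diag_mx v *m x) |
    x in [set x : 'cV[R]_n | l2norm x <= 1]] c.
  exists (delta_mx k 0) => /=.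
    by rewrite -[delta_mx k 0]scale1r l2e normr1.
  rewrite -vk -l2e; congr l2norm; apply/matrixP => i j.
  by rewrite mul_diag_mx !mxE ord1; case: eqVneq => [->|]; rewrite ?mulr0.
apply/eqP; rewrite eq_le; apply/andP; split.
  by apply: ge_sup => //; exists c.
by apply: ub_le_sup => //; exists c.
Qed.

Lemma invmx_diag_mx (F : fieldType) (n : nat) (v : 'rV[F]_n) :
  (forall i, v 0 i != 0) ->
  diag_mx v \in unitmx /\ invmx (diag_mx v) = diag_mx (\row_i (v 0 i)^-1).
Proof.
move=> v0; have vV : diag_mx v *m diag_mx (\row_i (v 0 i)^-1) = 1%:M.
  rewrite mulmx_diag -diag_const_mx; congr diag_mx.
  by apply/rowP => i; rewrite !mxE divff.
have [vu _] := mulmx1_unit vV; split=> //.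
by rewrite -[RHS](mulKmx vu) vV mulmx1.
Qed.

(** * The norm of the inverse *)

(** This is where [M <= N] matters: otherwise [N ^_ M = 0] and the diagonal
    operator is singular. *)
Lemma dcoef_gt0 (R : realType) (d M N : nat) (a : coords d M) :
  (M <= N)%N -> 0 < dcoef R N a.
Proof.
by move=> MN; rewrite (lt_le_trans (ffratio_gt0 R MN))// ffratio_le_dcoef.
Qed.

Lemma inv_sqrt_dcoef_le_chi (R : realType) (d M N : nat) (a : coords d M) :
  (M <= N)%N -> (Num.sqrt (dcoef R N a))^-1 <= chi R M N.
Proof.
move=> MN; rewrite chiE lef_pV2 ?posrE ?sqrtr_gt0 ?dcoef_gt0 ?ffratio_gt0//.
by rewrite ler_wsqrtr// ffratio_le_dcoef.
Qed.

Lemma exists_inv_sqrt_dcoef_eq_chi (R : realType) (d M N : nat) : (1 <= d)%N ->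
  exists a : coords d M, (Num.sqrt (dcoef R N a))^-1 = chi R M N.
Proof.
move=> d1; exists (Coords (retained_pure_multiindex M d1)).
by rewrite /= dcoef_pure_multiindex chiE.
Qed.

Lemma chi_ge0 (R : realType) (M N : nat) : 0 <= chi R M N.
Proof. exact: sqrtr_ge0. Qed.

Lemma chi_gt0 (R : realType) (M N : nat) : (M <= N)%N -> 0 < chi R M N.
Proof. by move=> MN; rewrite chiE invr_gt0 sqrtr_gt0 ffratio_gt0. Qed.

Lemma bigmax_inv_sqrt_dcoef (R : realType) (d M N : nat) :
  (1 <= d)%N -> (M <= N)%N ->
  \big[Num.max/0]_(a : coords d M) (Num.sqrt (dcoef R N a))^-1 = chi R M N.
Proof.
move=> d1 MN; apply/eqP; rewrite eq_le; apply/andP; split.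
  by apply: bigmax_le => [|a _]; rewrite ?chi_ge0 ?inv_sqrt_dcoef_le_chi.
have [a <-] := exists_inv_sqrt_dcoef_eq_chi R M N d1.
exact: (le_bigmax _ (fun a : coords d M => (Num.sqrt (dcoef R N a))^-1)).
Qed.

Lemma opnorm_invmx_diagop (R : realType) (d M N : nat) :
  (1 <= d)%N -> (M <= N)%N ->
  diagop R d M N \in unitmx /\ opnorm (invmx (diagop R d M N)) = chi R M N.
Proof.
move=> d1 MN; rewrite /diagop; set v := \row_i _.
have v0 i : v 0 i != 0 by rewrite mxE gt_eqF// sqrtr_gt0 dcoef_gt0.
have [vu ->] := invmx_diag_mx v0; split=> //.
have [a aE] := exists_inv_sqrt_dcoef_eq_chi R M N d1.
apply: (@opnorm_diag_mx _ _ _ _ (enum_rank a)) => [i|]; rewrite !mxE.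
  by rewrite ger0_norm ?invr_ge0 ?sqrtr_ge0// inv_sqrt_dcoef_le_chi.
by rewrite enum_rankK aE ger0_norm ?chi_ge0.
Qed.

(** * Two-sided estimate of the logarithm *)

Lemma ln_sqrt (R : realType) (x : R) : 0 < x -> ln (Num.sqrt x) = ln x / 2.
Proof.
move=> x0; rewrite -[in RHS](sqr_sqrtr (ltW x0)) lnXn ?sqrtr_gt0//.
by rewrite -[_ *+ 2]mulr_natr mulfK.
Qed.

Lemma ln_chiS (R : realType) (m N : nat) : (m < N)%N ->
  ln (chi R m.+1 N) = ln (chi R m N) + ln (N%:R / (N%:R - m%:R)) / 2.
Proof.
move=> mN; have Nm0 : 0 < N%:R - m%:R :> R by rewrite subr_gt0 ltr_nat.
have N0 : 0 < N%:R :> R by rewrite ltr0n (leq_trans _ mN).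
have N_Nm0 : 0 < N%:R / (N%:R - m%:R) :> R by rewrite divr_gt0.
have -> : chi R m.+1 N = chi R m N * Num.sqrt (N%:R / (N%:R - m%:R)).
  rewrite /chi -sqrtrM ?divr_ge0 ?exprn_ge0//; congr Num.sqrt.
  rewrite ffactnSr natrM natrB 1?ltnW// exprSr mulf_div //.
by rewrite lnM ?posrE ?chi_gt0 ?sqrtr_gt0 1?ltnW// ln_sqrt.
Qed.

(** Both bounds are [ln (1 + z) <= z]: with [z = y / (x - y)] for the upper one,
    and with [z = - (y / x)], after inverting the quotient, for the lower one. *)
Lemma ln_ratio_bounds (R : realType) (x y : R) : 0 <= y -> y < x ->
  y / x <= ln (x / (x - y)) <= y / (x - y).
Proof.
move=> y0 yx; have x0 : 0 < x by apply: le_lt_trans yx.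
have xy0 : 0 < x - y by rewrite subr_gt0.
apply/andP; split; last first.
  have -> : x / (x - y) = 1 + y / (x - y) by field; rewrite gt_eqF.
  by rewrite le_ln1Dx// (lt_le_trans (ltrN10 _))// divr_ge0// ltW.
rewrite -[x / _]invf_div lnV ?posrE ?divr_gt0// lerNr.
have -> : (x - y) / x = 1 + - (y / x) by field; rewrite gt_eqF.
by rewrite le_ln1Dx// ltrN2 ltr_pdivrMr// mul1r.
Qed.

(** The increments are at least [m / (2 N)], and the sum of the [m < M] is
    [M (M - 1) / 2]. *)
Lemma ln_chi_ge (R : realType) (M N : nat) : (M <= N)%N ->
  M%:R * (M%:R - 1) / (4 * N%:R) <= ln (chi R M N).
Proof.
elim: M => [|m IH mN].
  by rewrite !mul0r /chi expr0 ffactn0 divr1 sqrtr1 ln1.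
have N0 : 0 < N%:R :> R by rewrite ltr0n (leq_trans _ mN).
have mNR : m%:R < N%:R :> R by rewrite ltr_nat.
have /andP[lb _] := ln_ratio_bounds (ler0n R m) mNR.
rewrite ln_chiS// -[m.+1%:R]natr1.
have -> : (m%:R + 1) * (m%:R + 1 - 1) / (4 * N%:R) =
    m%:R * (m%:R - 1) / (4 * N%:R) + m%:R / N%:R / 2 :> R.
  by field; rewrite gt_eqF.
by rewrite lerD ?IH 1?ltnW// ler_wpM2r.
Qed.

(** The increments are at most [m / (2 (N - m))], and [N - m >= N - M + 1] as
    [m < M]. *)
Lemma ln_chi_le (R : realType) (M N : nat) : (M <= N)%N ->
  ln (chi R M N) <= M%:R * (M%:R - 1) / (4 * (N%:R - M%:R + 1)).
Proof.
move=> MN; set D : R := N%:R - M%:R + 1.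
have D0 : 0 < D by rewrite ltr_wpDl// subr_ge0 ler_nat.
(* The denominator involves the final value M, so it is fixed before the
   induction on the number m of factors. *)
suff H m : (m <= M)%N -> ln (chi R m N) <= m%:R * (m%:R - 1) / (4 * D).
  exact: H.
elim: m => [|m IH mM].
  by rewrite !mul0r /chi expr0 ffactn0 divr1 sqrtr1 ln1.
have mN := leq_trans mM MN.
have mNR : m%:R < N%:R :> R by rewrite ltr_nat.
have /andP[_ ub] := ln_ratio_bounds (ler0n R m) mNR.
rewrite ln_chiS// -[m.+1%:R]natr1.
have -> : (m%:R + 1) * (m%:R + 1 - 1) / (4 * D) =
    m%:R * (m%:R - 1) / (4 * D) + m%:R / D / 2 :> R.
  by field; rewrite gt_eqF.
rewrite lerD ?IH 1?ltnW// ler_wpM2r// (le_trans ub)//.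
rewrite ler_wpM2l// lef_pV2 ?posrE ?subr_gt0//.
have : m.+1%:R <= M%:R :> R by rewrite ler_nat.
by rewrite -[m.+1%:R]natr1 /D; lra.
Qed.

(** * Asymptotic regimes *)

(** [M / N] is [M / sqrt N] divided by [sqrt N], which tends to infinity. *)
Lemma cvg_div_of_div_sqrt (R : realType) (M N : nat -> nat) (c : R) :
  N @ \oo --> \oo ->
  (M k)%:R / Num.sqrt ((N k)%:R : R) @[k --> \oo] --> c ->
  (M k)%:R / (N k)%:R @[k --> \oo] --> (0 : R).
Proof.
move=> /(@cvgrnyP R) Noo Mc.
have sNoo : Num.sqrt ((N k)%:R : R) @[k --> \oo] --> +oo%R.
  apply/cvgryPge => A; near=> k.
  rewrite (le_trans (ler_norm A))// -sqrtr_sqr ler_wsqrtr//.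
  by near: k; move/cvgryPge : Noo; exact.
have sV0 : (Num.sqrt ((N k)%:R : R))^-1 @[k --> \oo] --> (0 : R).
  by apply/gtr0_cvgV0 => //; move/cvgryPgt : sNoo; exact.
have -> : (0 : R) = c * 0 by rewrite mulr0.
apply: cvg_trans (cvgM Mc sV0); apply: near_eq_cvg; near=> k.
by rewrite /= -mulrA -invfM -expr2 sqr_sqrtr.
Unshelve. all: by end_near. Qed.

(** Squeeze: the two bounds of [ln chi] differ by the factor
    [1 - M / N + 1 / N], which tends to [1]. *)
Lemma cvg_chi (R : realType) (M N : nat -> nat) (c : R) :
  (forall k, (M k <= N k)%N) -> N @ \oo --> \oo ->
  (M k)%:R / Num.sqrt ((N k)%:R : R) @[k --> \oo] --> c ->
  chi R (M k) (N k) @[k --> \oo] --> expR (c ^+ 2 / 4).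
Proof.
move=> MN Noo Mc.
have MN0 := cvg_div_of_div_sqrt Noo Mc.
pose t k : R := (M k)%:R / Num.sqrt (N k)%:R.
pose u k : R := (M k)%:R / (N k)%:R.
have N0 : \forall k \near \oo, 0 < (N k)%:R :> R.
  by move/(@cvgrnyP R)/cvgryPgt : Noo; exact.
have NV0 : (N k)%:R^-1 @[k --> \oo] --> (0 : R).
  by apply/gtr0_cvgV0 => //; apply/cvgrnyP.
have tE k : (M k)%:R ^+ 2 / (N k)%:R = t k ^+ 2.
  by rewrite /t expr_div_n sqr_sqrtr.
have lo : (t k ^+ 2 - u k) / 4 @[k --> \oo] --> c ^+ 2 / 4.
  rewrite -[c ^+ 2]subr0; apply: cvgMl; apply: cvgB => //.
  by rewrite expr2; under eq_fun do rewrite expr2; exact: cvgM.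
have up : (t k ^+ 2 - u k) / 4 / (1 - u k + (N k)%:R^-1) @[k --> \oo]
    --> c ^+ 2 / 4.
  have -> : c ^+ 2 / 4 = c ^+ 2 / 4 / (1 - 0 + 0) by rewrite subr0 addr0 divr1.
  apply: cvgM => //; apply: cvgV; first by rewrite subr0 addr0 oner_neq0.
  by apply: cvgD => //; apply: cvgB => //; exact: cvg_cst.
have lnc : ln (chi R (M k) (N k)) @[k --> \oo] --> c ^+ 2 / 4.
  apply: squeeze_cvgr lo up; near=> k.
  have Nk0 : 0 < (N k)%:R :> R by near: k.
  have D0 : 0 < (N k)%:R - (M k)%:R + 1 :> R.
    by rewrite ltr_wpDl// subr_ge0 ler_nat.
  have -> : (t k ^+ 2 - u k) / 4 = (M k)%:R * ((M k)%:R - 1) / (4 * (N k)%:R).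
    by rewrite -tE /u; field; rewrite gt_eqF.
  rewrite ln_chi_ge//= (le_trans (ln_chi_le R (MN k)))// le_eqVlt.
  apply/orP; left; apply/eqP; rewrite /u; field.
  by rewrite !gt_eqF//.
have chiK k : expR (ln (chi R (M k) (N k))) = chi R (M k) (N k).
  by rewrite lnK// posrE chi_gt0.
under eq_fun do rewrite -chiK.
exact: continuous_cvg (@continuous_expR R (c ^+ 2 / 4)) lnc.
Unshelve. all: by end_near. Qed.

(** A polynomial form of the lower bound, valid without any asymptotic
    assumption: it combines [expR x >= 1 + x] with [M / N <= 1]. *)
Lemma chi_ge (R : realType) (M N : nat) : (M <= N)%N ->
  3 / 4 + M%:R ^+ 2 / N%:R / 4 <= chi R M N.
Proof.
move=> MN; rewrite -[leRHS]lnK ?posrE ?chi_gt0//.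
rewrite (le_trans _ (expR_ge1Dx _))// -lerBlDl (le_trans _ (ln_chi_ge R MN))//.
have u1 : M%:R / N%:R <= 1 :> R.
  have [->|N0] := posnP N; first by rewrite invr0 mulr0.
  by rewrite ler_pdivrMr ?ltr0n// mul1r ler_nat.
by rewrite mulrBr mulr1 invfM mulrCA mulrBl expr2; lra.
Qed.

Lemma cvgy_chi (R : realType) (M N : nat -> nat) :
  (forall k, (M k <= N k)%N) ->
  (M k)%:R / Num.sqrt ((N k)%:R : R) @[k --> \oo] --> +oo%R ->
  chi R (M k) (N k) @[k --> \oo] --> +oo%R.
Proof.
move=> MN /cvgryPge toy; apply/cvgryPge => A; near=> k.
apply: le_trans (chi_ge R (MN k)).
(* With t = M / sqrt N >= 4 |A| + 1 >= 1, one has t^2 / 4 >= t / 4 >= A. *)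
have : 4 * `|A| + 1 <= (M k)%:R / Num.sqrt ((N k)%:R : R) by near: k.
rewrite -[in X in _ -> X](@sqr_sqrtr _ (N k)%:R)// -expr_div_n.
by have := ler_norm A; have := normr_ge0 A; nra.
Unshelve. all: by end_near. Qed.

(** The upper bound of [ln chi] could blow up only when [N - M + 1] is small
    compared with [N].  If [N >= 2 M], then [N - M >= N / 2] and the bound is at
    most [C / 2].  Otherwise [M ^ 2 <= C N <= 2 C M] forces [M <= 2 C], and the
    bound is at most [M ^ 2 / 4 <= C ^ 2]. *)
Lemma ln_chi_le_of_sqr_div_le (R : realType) (M N : nat) (C : R) :
  (M <= N)%N -> M%:R ^+ 2 / N%:R <= C -> ln (chi R M N) <= C + C ^+ 2.
Proof.
move=> MN MC; rewrite (le_trans (ln_chi_le R MN))//.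
have D0 : 0 < N%:R - M%:R + 1 :> R by rewrite ltr_wpDl// subr_ge0 ler_nat.
have C0 : 0 <= C by apply: le_trans MC; rewrite divr_ge0 ?sqr_ge0.
have [N0|Npos] := posnP N.
  move: MN; rewrite N0 leqn0 => /eqP ->; rewrite !mul0r.
  by rewrite addr_ge0 ?sqr_ge0.
have MCN : M%:R ^+ 2 <= C * N%:R by rewrite -ler_pdivrMr ?ltr0n.
have M0 : 0 <= M%:R :> R by [].
have NM : M%:R <= N%:R :> R by rewrite ler_nat.
rewrite ler_pdivrMr ?mulr_gt0//.
have [N2M|N2M] := leP (2 * M%:R) (N%:R : R); first by nra.
have M2C : M%:R <= 2 * C.
  have [->|Mpos] := posnP M; first by rewrite mulr_ge0.
  rewrite -(ler_pM2l (_ : 0 < M%:R :> R)) ?ltr0n// -expr2.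
  by rewrite (le_trans MCN)//; nra.
have M24C : M%:R ^+ 2 <= 4 * C ^+ 2 by nra.
(* The denominator N - M + 1 is at least 1. *)
have CD : 4 * C ^+ 2 <= (C + C ^+ 2) * (4 * (N%:R - M%:R + 1)) by nra.
by nra.
Qed.

(** The finitely many exceptional values have a maximum. *)
Lemma eventually_ubounded (R : realType) (f : nat -> R) :
  (exists C, \forall k \near \oo, f k <= C) <-> (exists C, forall k, f k <= C).
Proof.
split=> [[C [K _ fC]]|[C fC]]; last by exists C; near=> k; exact: fC.
exists (\big[Num.max/C]_(i < K) f i) => k.
have [Kk|kK] := leqP K k.
  by rewrite (le_trans (fC k Kk))// bigmax_ge_id.
exact: (le_bigmax C (fun i : 'I_K => f i) (Ordinal kK)).
Unshelve. all: by end_near. Qed.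

Lemma chi_bounded_iff (R : realType) (M N : nat -> nat) :
  (forall k, (M k <= N k)%N) ->
  (exists C, forall k, chi R (M k) (N k) <= C) <->
  (exists C : R, forall k, (M k)%:R ^+ 2 / (N k)%:R <= C).
Proof.
move=> MN; split=> [[C chiC]|[C MC]].
  exists (4 * C) => k; have := le_trans (chi_ge R (MN k)) (chiC k); lra.
exists (expR (C + C ^+ 2)) => k.
rewrite -[leLHS]lnK ?posrE ?chi_gt0// ler_expR.
exact: ln_chi_le_of_sqr_div_le.
Qed.

(** * The proposition *)

Unset Implicit Arguments.

Theorem proposition5p9 (R : realType) :
  (forall d M N : nat, (1 <= d)%N -> (M <= N)%N ->
    [/\ diagop R d M N \in unitmx,
        opnorm (invmx (diagop R d M N)) = chi R M N &
        \big[Num.max/0]_(a : coords d M) (Num.sqrt (dcoef R N a))^-1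
          = chi R M N]) /\
  (forall M N : nat, (M <= N)%N ->
    M%:R * (M%:R - 1) / (4 * N%:R) <= ln (chi R M N)
      <= M%:R * (M%:R - 1) / (4 * (N%:R - M%:R + 1))) /\
  (forall M N : nat -> nat, (forall k, (M k <= N k)%N) -> N @ \oo --> \oo ->
    (forall c : R, (M k)%:R / Num.sqrt ((N k)%:R : R) @[k --> \oo] --> c ->
       chi R (M k) (N k) @[k --> \oo] --> expR (c ^+ 2 / 4)) /\
    ((M k)%:R / Num.sqrt ((N k)%:R : R) @[k --> \oo] --> +oo%R ->
       chi R (M k) (N k) @[k --> \oo] --> +oo%R)) /\
  (forall d M N : nat -> nat, (forall k, (1 <= d k)%N) ->
    (forall k, (M k <= N k)%N) ->
    (exists C : R, \forall k \near \oo,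
       opnorm (invmx (diagop R (d k) (M k) (N k))) <= C) <->
    (exists C : R, forall k, (M k)%:R ^+ 2 / (N k)%:R <= C)).
Proof.
split; [|split; [|split]].
- move=> d M N d1 MN; have [Du opE] := opnorm_invmx_diagop R d1 MN.
  by split; rewrite ?bigmax_inv_sqrt_dcoef.
- by move=> M N MN; rewrite ln_chi_ge ?ln_chi_le.
- move=> M N MN Noo; split=> [c|]; first exact: cvg_chi.
  exact: cvgy_chi.
- move=> d M N d1 MN; rewrite eventually_ubounded -chi_bounded_iff//.
  by split=> -[C opC]; exists C => k; have := opC k;
    rewrite (opnorm_invmx_diagop R (d1 k) (MN k)).2.
Qed.
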